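(* Let $G=(V,E)$ be a finite undirected graph with $N=|V|$ nodes whose node set is partitioned into a set $\mathcal{C}$ of (nonempty) categories, let $A\in\mathcal{C}$, and let $S$ be a uniform independence sample of size $n$ from $V$. Then the induced-subgraph estimator of category size $$|\widehat{A}| = N\cdot\frac{|S_A|}{|S|}$$ is consistent for $|A|$, i.e. $|\widehat{A}|\to |A|$ in probability as $n\to\infty$.
   Context: Uniform independence sampling (UIS): $X_1,X_2,\dots$ are i.i.d. random nodes uniformly distributed on $V$ (sampling with replacement), and $S$ is the multiset $\{X_1,\dots,X_n\}$, so $|S|=n$ (multiplicities counted). For a category $A$, $S_A=\{v\in S: v\in A\}$ is the sub-multiset of samples lying in $A$, with $|S_A|$ counted with multiplicity. $G$ and $N$ are fixed. *)

(* Defs.v *)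
From mathcomp Require Import all_boot all_order all_algebra.
From mathcomp Require Import finmap.
From mathcomp Require Import all_classical all_reals all_analysis.

Set Implicit Arguments.
Unset Strict Implicit.
Unset Printing Implicit Defensive.

Import Order.TTheory GRing.Theory Num.Theory.
Import numFieldNormedType.Exports.

Local Open Scope classical_set_scope.
Local Open Scope ring_scope.

(* A random variable with values in the finite set V, which carries the discrete
   sigma-algebra. [{RV P >-> V}] is not used, because a [measurableType] must be
   pointed, whereas V is an arbitrary [finType]. *)
Definition random_node d (T : measurableType d) (V : finType) (X : T -> V) :
    Prop :=
  forall B : set V, measurable (X @^-1` B).

(* The product rule is required for every finite subfamily. *)
Definition mutually_independent d (T : measurableType d) (R : realType)
    (P : probability T R) (V : finType) (X : nat -> T -> V) : Prop :=
  forall (J : {fset nat}) (B : nat -> set V),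
    P (\bigcap_(i in [set` J]) (X i @^-1` B i)) =
      (\prod_(i <- J) P (X i @^-1` B i))%E.

Definition uniform_node d (T : measurableType d) (R : realType)
    (P : probability T R) (V : finType) (X : T -> V) : Prop :=
  forall v : V, P (X @^-1` [set v]) = (#|V|%:R^-1)%:E.

(* Indices start at 0: [X i] is the (i+1)-st draw. *)
Definition uis d (T : measurableType d) (R : realType) (P : probability T R)
    (V : finType) (X : nat -> T -> V) : Prop :=
  [/\ forall i, random_node (X i),
      mutually_independent P X
    & forall i, uniform_node P (X i)].

(* The multiset of the first n draws, as a sequence: repeated nodes are kept, so
   [size] counts multiplicities. *)
Definition sample (T : Type) (V : finType) (X : nat -> T -> V) (n : nat)
    (w : T) : seq V :=
  mkseq (fun i => X i w) n.

Definition subsample (V : finType) (S : seq V) (A : {set V}) : seq V :=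
  [seq v <- S | v \in A].

(* For the empty sample this is 0, because of the convention x / 0 = 0. *)
Definition size_estimator (R : realType) (V : finType) (A : {set V})
    (S : seq V) : R :=
  #|V|%:R * ((size (subsample S A))%:R / (size S)%:R).

Definition cvg_in_probability d (T : measurableType d) (R : realType)
    (P : probability T R) (Y : nat -> T -> R) (Z : T -> R) : Prop :=
  forall eps : R, 0 < eps ->
    (fun n => P [set w | eps <= `|Y n w - Z w|]) @ \oo --> 0%E.

(* Main.v *)
Require Import Defs.
From mathcomp Require Import all_boot all_order all_algebra.
From mathcomp Require Import finmap.
From mathcomp Require Import all_classical all_reals all_analysis.
From mathcomp Require Import measurable_realfun.
From mathcomp Require Import ring.

(* Writing S_A as a sum of the indicators of the events X_i \in A, the estimator
   is N times an empirical mean of pairwise independent indicators, each of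
   expectation |A| / N. The variance of this mean is O(1 / n), so Chebyshev's
   inequality applies. *)

Set Implicit Arguments.
Unset Strict Implicit.
Unset Printing Implicit Defensive.

Import Order.TTheory GRing.Theory Num.Theory.
Import numFieldNormedType.Exports.

Local Open Scope classical_set_scope.
Local Open Scope ring_scope.

Section WeakLaw.
Context d (T : measurableType d) (R : realType) (P : probability T R).

Lemma Lfun2_Lfun1 (f : T -> R) : f \in Lfun P 2%:E -> f \in Lfun P 1.
Proof. by apply: Lfun_subset12; exact: fin_num_measure. Qed.

Lemma Lfun_indic (E : set T) (r : R) : 0 < r -> measurable E ->
  (\1_E : T -> R) \in Lfun P r%:E.
Proof.
move=> r0 mE; rewrite inE; apply/andP; split; rewrite inE/=.
  exact: measurable_indic.
rewrite /finite_norm unlock /Lnorm poweR_lty//.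
(* As [0 < r], the function [|\1_E| ^ r] is [\1_E] itself, with integral [P E], which is finite. *)
rewrite (eq_integral (fun x => (\1_E x)%:E)) => [|x _].
  by rewrite integral_indic// setIT ltey_eq fin_num_measure.
rewrite /= indicE; case: (x \in E) => /=; first by rewrite normr1 powR1.
by rewrite normr0 powR0// gt_eqF.
Qed.

Lemma Lfun_sum (Y : nat -> T -> R) (n : nat) :
  (forall i, Y i \in Lfun P 2%:E) -> \sum_(i < n) Y i \in Lfun P 2%:E.
Proof. by move=> Y2; apply: rpred_sum; rewrite ?lee1n. Qed.

Lemma expectation_sum_ord (Y : nat -> T -> R) (n : nat) :
  (forall i, Y i \in Lfun P 2%:E) ->
  ('E_P[(\sum_(i < n) Y i)%R] = \sum_(i < n) 'E_P[Y i])%E.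
Proof.
move=> Y2; elim: n => [|n IH]; first by rewrite !big_ord0 expectation_cst.
rewrite !big_ord_recr/= -IH expectationD//; apply: Lfun2_Lfun1 => //.
exact: Lfun_sum.
Qed.

Lemma covariance_suml (Y : nat -> T -> R) (Z : T -> R) (n : nat) :
  (forall i, Y i \in Lfun P 2%:E) -> Z \in Lfun P 2%:E ->
  (covariance P (\sum_(i < n) Y i)%R Z = \sum_(i < n) covariance P (Y i) Z)%E.
Proof.
move=> Y2 Z2; elim: n => [|n IH]; first by rewrite !big_ord0 covariance_cst_l.
by rewrite !big_ord_recr/= -IH covarianceDl//; exact: Lfun_sum.
Qed.

Lemma variance_sum_uncorrelated (Y : nat -> T -> R) (n : nat) :
  (forall i, Y i \in Lfun P 2%:E) ->
  (forall i j, i != j -> covariance P (Y i) (Y j) = 0%E) ->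
  ('V_P[(\sum_(i < n) Y i)%R] = \sum_(i < n) 'V_P[Y i])%E.
Proof.
move=> Y2 Y0; elim: n => [|n IH]; first by rewrite !big_ord0 variance_cst.
rewrite !big_ord_recr/= -IH varianceD//; last exact: Lfun_sum.
(* The cross term splits into covariances of [Y i] with [Y n] for [i < n], all zero. *)
rewrite covariance_suml// [X in (2%:E * X)%E]big1 ?mule0 ?adde0// => i _.
by rewrite Y0// neq_ltn ltn_ord.
Qed.

(** Chebyshev's inequality for the unnormalised sum of [k] terms, with threshold [k * eps], gives
    the bound [k * v / (k * eps) ^ 2 = v / (eps ^ 2 * k)], which tends to 0. *)
Lemma weak_law_uncorrelated (Y : nat -> T -> R) (m v : R) :
  (forall i, Y i \in Lfun P 2%:E) ->
  (forall i j, i != j -> covariance P (Y i) (Y j) = 0%E) ->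
  (forall i, 'E_P[Y i] = m%:E)%E -> (forall i, 'V_P[Y i] <= v%:E)%E ->
  cvg_in_probability P (fun n w => (\sum_(i < n) Y i w) / n%:R) (fun=> m).
Proof.
move=> Y2 Y0 Ym Yv eps eps0.
have h0 : ((eps ^- 2 * v)%:E * (harmonic n)%:E)%E @[n --> \oo] --> 0%E.
  by rewrite -[0%E](mule0 (eps ^- 2 * v)%:E); apply: cvgeZl cvge_harmonic.
(* The shift discards the empty mean at [n = 0] and matches [harmonic n], which is [1 / (n + 1)]. *)
rewrite -(cvg_shiftS _); apply: (squeeze_cvge _ (cvg_cst 0%E) h0).
apply: nearW => n; rewrite measure_ge0/=.
have S2 := Lfun_sum n.+1 Y2.
pose S : {RV P >-> R} := mfun_Sub (sub_Lfun_mfun S2).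
have n0 : 0 < n.+1%:R :> R by [].
have ES : ('E_P[S] = (n.+1%:R * m)%:E)%E.
  rewrite expectation_sum_ord//; under eq_bigr do rewrite Ym.
  by rewrite sumEFin sumr_const card_ord mulr_natl.
have VS : ('V_P[S] <= (n.+1%:R * v)%:E)%E.
  rewrite variance_sum_uncorrelated//.
  apply: (@le_trans _ _ (\sum_(i < n.+1) v%:E)%E); first exact: lee_sum.
  by rewrite sumEFin sumr_const card_ord mulr_natl.
have := chebyshev S (mulr_gt0 n0 eps0).
rewrite ES/=.
(* Multiplying the deviation of the mean by [n.+1] gives that of the sum, so both events are the
   same. *)
rewrite [X in (P X <= _)%E](_ : _ =
  [set w | eps <= `|(\sum_(i < n.+1) Y i w) / n.+1%:R - m|]); last first.
  apply: eq_set => w; congr is_true; rewrite fct_sumE -[RHS](ler_pM2l n0).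
  rewrite -{4}(gtr0_norm n0) -normrM mulrBr.
  by rewrite [n.+1%:R * (_ / _)]mulrCA divff ?gt_eqF// mulr1.
move=> /le_trans; apply; apply: (le_trans (lee_wpmul2l _ VS)).
  by rewrite lee_fin invr_ge0 exprn_ge0// mulr_ge0// ltW.
have [n1 e1] : n.+1%:R != 0 :> R /\ eps != 0 by rewrite !gt_eqF.
rewrite -!EFinM lee_fin [leLHS](_ : _ = eps ^- 2 * v / n.+1%:R)//.
field; exact/andP.
Qed.

Lemma weak_law_indic (E : nat -> set T) (p : R) :
  (forall i, measurable (E i)) -> (forall i, P (E i) = p%:E) ->
  (forall i j, i != j -> P (E i `&` E j) = (P (E i) * P (E j))%E) ->
  cvg_in_probability P (fun n w => (\sum_(i < n) \1_(E i) w) / n%:R) (fun=> p).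
Proof.
move=> mE Ep EI.
have E2 i : (\1_(E i) : T -> R) \in Lfun P 2%:E by apply: Lfun_indic.
have EE i : ('E_P[\1_(E i)] = p%:E)%E by rewrite expectation_indic// Ep.
(* [p - p ^+ 2] is the Bernoulli variance: an indicator equals its own square. Covariances vanish
   because the product of two indicators is that of the intersection. *)
apply: (@weak_law_uncorrelated (fun i => \1_(E i)) p (p - p ^+ 2)) => //
  [i j ij|i].
  rewrite covarianceE ?Lfun2_mul_Lfun1 ?Lfun2_Lfun1//.
  rewrite [X in ('E_P[X])%E](_ : _ = \1_(E i `&` E j)); last by rewrite indicI.
  by rewrite !expectation_indic ?EI ?Ep -?EFinM ?subee//; exact: measurableI.
rewrite varianceE// EE.
rewrite [X in ('E_P[X])%E](_ : _ = \1_(E i)) ?EE//; last first.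
  apply/funext => w; rewrite !fctE indicE.
  by case: (_ \in _); rewrite ?expr1n ?expr0n.
Qed.

End WeakLaw.

Section UIS.
Context d (T : measurableType d) (R : realType) (P : probability T R).
Variables (V : finType) (X : nat -> T -> V).
Hypothesis X_uis : uis P X.

Lemma uis_measurable i (B : set V) : measurable (X i @^-1` B).
Proof. by case: X_uis => mX _ _; exact: mX. Qed.

Lemma uis_probability i (A : {set V}) :
  P (X i @^-1` [set` A]) = (#|A|%:R / #|V|%:R)%:E.
Proof.
(* The event is the disjoint union of the fibres of [X i] over the nodes of [A], each of mass
   [1 / #|V|]. *)
rewrite [X in P X](_ : _ =
    \bigcup_(v in [set` enum A]) (X i @^-1` [set v])); last first.
  apply/seteqP; split=> [w /= Xw|w [v /= + ->]]; last by rewrite mem_enum.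
  by exists (X i w); rewrite //= mem_enum.
rewrite measure_fin_bigcup//=; last first.
- by move=> v _; exact: uis_measurable.
- by move=> u v _ _ [w [/= <- <-]].
rewrite -fsbig_seq ?enum_uniq// big_enum/=.
case: X_uis => _ _ unif; under eq_bigr do rewrite unif.
by rewrite sumEFin sumr_const mulr_natl.
Qed.

Lemma uis_pairwise_independent i j (B : set V) : i != j ->
  P ((X i @^-1` B) `&` (X j @^-1` B)) = (P (X i @^-1` B) * P (X j @^-1` B))%E.
Proof.
move=> ij; case: X_uis => _ indep _.
(* Since [i != j], the product over this two-element set has exactly two factors. *)
have := indep [fset i; j]%fset (fun=> B).
rewrite big_fsetU1 ?inE//= big_seq_fset1 => <-; congr (P _).
apply/seteqP; split=> [w [/= Xi Xj] k /=|w H].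
  by rewrite !inE => /orP[] /eqP ->.
by split; apply: H; rewrite /= !inE eqxx ?orbT.
Qed.

Lemma size_subsample_sum (A : {set V}) n w :
  (size (subsample (sample X n w) A))%:R =
  \sum_(i < n) \1_(X i @^-1` [set` A]) w :> R.
Proof.
rewrite /subsample size_filter /sample /mkseq -sumn_count sumnE !big_map.
rewrite natr_sum -[n in iota 0 n]subn0 -/(index_iota 0 n) big_mkord.
apply: eq_bigr => i _; rewrite indicE; congr (nat_of_bool _)%:R.
by apply/idP/idP; rewrite inE.
Qed.

End UIS.

Theorem mainTheorem1 (V : finType) (E : rel V) (E_sym : symmetric E)
    (C : {set {set V}}) (C_part : finset.partition C (finset.setTfor V))
    (A : {set V}) (A_in : A \in C)
    (R : realType) (d : measure_display) (T : measurableType d)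
    (P : probability T R) (X : nat -> T -> V) (X_uis : uis P X) :
  cvg_in_probability P (fun n w => size_estimator R A (sample X n w))
    (fun _ => #|A|%:R%R).
Proof.
(* A block of a partition is nonempty, so [A] provides a node; this allows division by [#|V|]. *)
have V0 : 0 < #|V|%:R :> R.
  rewrite ltr0n; case/and3P: C_part => _ _ C0.
  have /set0Pn[v _] : A != finset.set0 by apply: contraNneq C0 => <-.
  by apply/card_gt0P; exists v.
have WLLN := weak_law_indic (fun i => uis_measurable X_uis i [set` A])
  (fun i => uis_probability X_uis i A)
  (fun i j => @uis_pairwise_independent _ _ _ _ _ _ X_uis i j [set` A]).
(* The estimator is [#|V|] times the empirical mean, so its deviation reaches [eps] exactly when
   that of the mean reaches [eps / #|V|]. The events agree for every [n], even [n = 0], where both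
   quotients are 0 by convention. *)
move=> eps eps0; have := WLLN _ (divr_gt0 eps0 V0).
apply: cvg_trans; apply: near_eq_cvg; apply: nearW => n /=.
congr (P _); apply: eq_set => w; congr is_true.
rewrite /size_estimator size_subsample_sum size_mkseq.
rewrite ler_pdivrMr// -{2}(gtr0_norm V0) -normrM mulrBl divfK ?gt_eqF//.
by rewrite mulrC.
Qed.
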